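(* Let $X$ be a real Hausdorff locally convex space, $T$ a topological space, $f_t:X\to\overline{\mathbb{R}}$ ($t\in T$) convex functions, and $f:=\sup_{t\in T}f_t$. Assume that $$\operatorname{cl}f=\sup_{t\in T}(\operatorname{cl}f_t).$$ Let $x\in X$ be such that for some $\varepsilon_0>0$: (i) the set $T_{\varepsilon_0}(x)$ is compact; (ii) for every $z\in\operatorname{dom}(\operatorname{cl}f)$, the function $t\mapsto(\operatorname{cl}f_t)(z)$ is upper semicontinuous on $T_{\varepsilon_0}(x)$. Then $$\partial f(x)=\bigcap_{\varepsilon>0,\ L\in\mathcal{F}(x)}\overline{\operatorname{co}}\Big\{\bigcup_{t\in T(x)}\partial_\varepsilon f_t(x)+\mathrm{N}_{L\cap\operatorname{dom}f}(x)\Big\},$$ where $\mathcal{F}(x)$ is the family of finite-dimensional linear subspaces $L$ of $X$ such that $x\in L$.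
   Context: $\overline{\mathbb{R}}=\mathbb{R}\cup\{\pm\infty\}$. $X^*$ is the topological dual of $X$, endowed with the weak*-topology, and $\langle\cdot,\cdot\rangle$ is the canonical pairing. For a convex $\varphi:X\to\overline{\mathbb{R}}$: $\operatorname{dom}\varphi=\{x\in X:\varphi(x)<+\infty\}$; $\operatorname{cl}\varphi$ is the lower semicontinuous envelope of $\varphi$; for $\varepsilon\ge0$ the $\varepsilon$-subdifferential is $\partial_\varepsilon\varphi(x)=\{x^*\in X^*:\varphi(y)-\varphi(x)\ge\langle x^*,y-x\rangle-\varepsilon\ \forall y\in X\}$ if $\varphi(x)\in\mathbb{R}$, and $\partial_\varepsilon\varphi(x)=\emptyset$ if $\varphi(x)\notin\mathbb{R}$; $\partial\varphi(x)=\partial_0\varphi(x)$. For a convex set $A\subset X$, the normal cone is $\mathrm{N}_A(x)=\{x^*\in X^*:\langle x^*,y-x\rangle\le0\ \forall y\in A\}$ if $x\in A$, and $\mathrm{N}_A(x)=\emptyset$ if $x\notin A$. Sums of sets are Minkowski sums (empty if one summand is empty). $\overline{\operatorname{co}}$ is the closed convex hull (weak*-closed for subsets of $X^*$). Active index sets: $T_\varepsilon(x)=\{t\in T: f_t(x)\ge f(x)-\varepsilon\}$ for $\varepsilon\ge0$, and $T(x)=\{t\in T: f_t(x)=f(x)\}$. *)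

(* Defs.v *)
From HB Require Import structures.
From mathcomp Require Import all_boot all_order all_algebra.
From mathcomp Require Import all_classical all_reals all_analysis.
Set Implicit Arguments.
Unset Strict Implicit.
Unset Printing Implicit Defensive.
Import Order.TTheory GRing.Theory Num.Theory.
Import numFieldNormedType.Exports.
Local Open Scope classical_set_scope.
Local Open Scope ring_scope.

Section Dual.
Context {R : realType} {X : tvsType R}.

Definition continuous_linear : {pred X -> R^o} :=
  mem [set u : X -> R^o | linear u /\ continuous u].

Lemma continuous_linear_submod_closed : submod_closed continuous_linear.
Proof.
split=> [|a u v].
  rewrite inE; split=> [b x y|x]; last exact: cst_continuous.
  by change (0 = b *: 0 + 0 :> R^o); rewrite scaler0 addr0.
rewrite !inE => -[lu cu] [lv cv]; split=> [b x y|x].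
  change (a *: u (b *: x + y) + v (b *: x + y) =
          b *: (a *: u x + v x) + (a *: u y + v y) :> R^o).
  by rewrite lu lv !scalerDr !scalerA (mulrC a b) addrACA.
apply: (@cvgD _ _ _ _ _ (fun y => a *: u y) v); last exact: cv.
exact: (@cvgZl_tmp R R^o _ _ _ a u (u x) (cu x)).
Qed.

HB.instance Definition _ := GRing.isSubmodClosed.Build R (X -> R^o)
  continuous_linear continuous_linear_submod_closed.

End Dual.

(* The topological dual X^*; u x is the pairing <u, x>. *)
Record dual (R : realType) (X : tvsType R) := Dual {
  dual_val :> X -> R^o ;
  dual_valP : dual_val \in continuous_linear }.

Section DualStructures.
Context {R : realType} {X : tvsType R}.

HB.instance Definition _ := [isSub for @dual_val R X].
HB.instance Definition _ := [Choice of dual X by <:].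
HB.instance Definition _ := [SubChoice_isSubLmodule of dual X by <:].

(* The weak* topology: the trace on X^* of pointwise convergence on X. *)
HB.instance Definition _ := Topological.copy (dual X)
  (initial_topology (@dual_val R X : dual X -> {ptws X -> R^o})).

End DualStructures.

Section ConvexAnalysis.
Context {R : realType} {X : tvsType R}.
Implicit Types (f : X -> \bar R) (A : set X) (x : X).

Definition epigraph f : set (X * R^o) := [set p | (f p.1 <= p.2%:E)%E].

(* Stated on the epigraph, so that no convention for (+oo) + (-oo) is needed. *)
Definition convex_efun f := convex_set (epigraph f).

Definition edom f : set X := [set x | (f x < +oo)%E].

(* No properness is imposed: the envelope may take the value -oo. *)
Definition lsc_envelope f : X -> \bar R := fun x =>
  ereal_sup [set g x | g in
    [set g : X -> \bar R | lower_semicontinuous g /\ forall y, (g y <= f y)%E]].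

Definition esubdiff (eps : R) f x : set (dual X) :=
  [set u | f x \is a fin_num /\
           forall y, ((u (y - x) - eps)%:E <= f y - f x)%E].

Definition subdiff f x : set (dual X) := esubdiff 0 f x.

Definition normal_cone A x : set (dual X) :=
  [set u | A x /\ forall y, A y -> u (y - x) <= 0].

Definition fin_dim_subspace (L : set X) := exists (n : nat) (v : 'I_n -> X),
  L = [set \sum_(i < n) c i *: v i | c in [set: 'I_n -> R]].

Definition fin_dim_subspaces_through x : set (set X) :=
  [set L | fin_dim_subspace L /\ L x].

End ConvexAnalysis.

Definition minkowski_sum (V : zmodType) (A B : set V) : set V :=
  [set a + b | a in A & b in B].

Definition closed_convex_hull (R : realType) (X : tvsType R)
    (A : set (dual X)) : set (dual X) :=
  \bigcap_(C in [set C : set (dual X) |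
                  [/\ closed C, convex_set C & A `<=` C]]) C.

Section Families.
Context {R : realType} {X : tvsType R} {T : topologicalType}.

(* The supremum of an empty family is the constant -oo. *)
Definition sup_fun (f_ : T -> X -> \bar R) : X -> \bar R := fun x => ereal_sup (range (f_ ^~ x)).

Definition eactive (f_ : T -> X -> \bar R) (eps : R) (x : X) : set T :=
  [set t | (sup_fun f_ x - eps%:E <= f_ t x)%E].

Definition active (f_ : T -> X -> \bar R) (x : X) : set T := [set t | f_ t x = sup_fun f_ x].

End Families.

(* Upper semicontinuity of the restriction of g to A, for the topology of A. *)
Definition usc_on (R : realType) (T : topologicalType) (A : set T)
    (g : T -> \bar R) :=
  lower_semicontinuous ((fun t => - g t)%E : subspace A -> \bar R).

(* Main.v *)
From HB Require Import structures.
Require Import Defs.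
From mathcomp Require Import all_boot all_order all_algebra.
From mathcomp Require Import all_classical all_reals all_analysis.
From mathcomp Require Import ring lra.
Set Implicit Arguments.
Unset Strict Implicit.
Unset Printing Implicit Defensive.
Import Order.TTheory GRing.Theory Num.Theory.
Import numFieldNormedType.Exports.
Local Open Scope classical_set_scope.
Local Open Scope ring_scope.

(** Write f for the supremum, g_t for the envelope cl f_t, and E for the set of
    eps0-active indices.

    That the intersection lies in the subdifferential is elementary: given y in
    dom f, take L spanned by x and y; every a + b in the sum of sets satisfies
    (a + b)(y - x) <= f y - f x + eps, this half-space is weak* closed and
    convex, and eps is arbitrary ([hull_subdiff]).

    For the converse, suppose that a subgradient u of f at x is outside a
    weak* closed convex set containing the sum, for some eps and L. A separation
    through finitely many evaluations gives z and del > 0 with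
    a z + b z <= u z - del for all eps-subgradients a of active functions and
    all normals b ([weak_star_separation]).

    The key is [slope_active]: in a direction z which leads from x into dom f,
    the eps-subgradients a of the active functions reach slopes a z arbitrarily
    close to u z. If they did not, every g_t with g_t x = f x would drop below
    the line s |-> f x + s u z somewhere on the ray, since otherwise the epigraph
    of g_t could be separated from a segment placed slightly below that line and
    the separating hyperplane would be an eps-subgradient of large slope
    ([esubdiff_slope]). The g_t with g_t x < f x start below that line anyway.
    Convexity propagates a drop to all smaller s, upper semicontinuity
    propagates it to neighbouring indices, and compactness of E makes it
    uniform; indices outside E start at least eps0 below f x. So cl f = sup g_t
    would be below the line at some point, although cl f inherits the affine
    minorant f x + u (. - x) from f.

    For z = 0 this yields one active eps-subgradient, and as normals form a cone
    the separation then forces b z <= 0 for all normals b: z is polar to the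
    normal cone, hence in the closure of the cone spanned by
    L `&` dom f - x. The direction z itself need not lead into dom f, but the set
    is finite dimensional and z + lam k does for every lam > 0, where k is a sum
    of vectors d_i - x, with d_i in L `&` dom f, that span all of
    L `&` dom f - x ([normal_cone_polar]). Since a k is bounded over the active
    eps-subgradients a, applying [slope_active] to z + lam k and letting lam tend
    to 0 contradicts the separation. *)

(** * Hahn-Banach separation of a point from an absorbing convex set *)

Section HahnBanach.
Context {R : realType} {V : lmodType R}.

Definition sublinear (p : V -> R) :=
  (forall x y, p (x + y) <= p x + p y) /\
  (forall a x, 0 < a -> p (a *: x) <= a * p x).

Lemma sublinear0 p : sublinear p -> p 0 = 0.
Proof.
move=> [pD pZ]; have := pD 0 0; have := pZ 2^-1 0 ltac:(lra).
rewrite addr0 scaler0; lra.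
Qed.

Lemma sublinearZ p a x : sublinear p -> 0 <= a -> p (a *: x) = a * p x.
Proof.
move=> sp; rewrite le_eqVlt => /orP[/eqP <-|a0].
  by rewrite scale0r mul0r sublinear0.
have [pD pZ] := sp; apply/le_anti; rewrite pZ//=.
have := pZ a^-1 (a *: x); rewrite invr_gt0 scalerA mulVf ?gt_eqF// scale1r.
by move=> /(_ a0); rewrite ler_pdivlMl.
Qed.

Lemma sublinearN p x : sublinear p -> - p (- x) <= p x.
Proof. by move=> sp; have := sp.1 x (- x); rewrite subrr sublinear0//; lra. Qed.

(** The largest sublinear functional below p whose value at - v is at most
    - p v; it is the tool that makes a minimal functional additive. *)
Definition ray_inf (p : V -> R) v x :=
  inf [set p (x + t *: v) - t * p v | t in [set t | 0 <= t]].

Lemma ray_inf_lb p v x : sublinear p ->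
  lbound [set p (x + t *: v) - t * p v | t in [set t | 0 <= t]] (- p (- x)).
Proof.
move=> sp _ [t /= t0 <-]; rewrite -(sublinearZ _ sp)//.
by have := sp.1 (x + t *: v) (- x); rewrite addrAC subrr add0r; lra.
Qed.

Lemma ray_inf_le p v x t : sublinear p -> 0 <= t ->
  ray_inf p v x <= p (x + t *: v) - t * p v.
Proof.
move=> sp t0; apply: ge_inf; last by exists t.
by exists (- p (- x)); exact: ray_inf_lb.
Qed.

Lemma ray_inf_ge p v x m :
  (forall t, 0 <= t -> m <= p (x + t *: v) - t * p v) -> m <= ray_inf p v x.
Proof.
move=> mle; apply: lb_le_inf; last by move=> _ [t t0 <-]; exact: mle.
by exists (p (x + 0 *: v) - 0 * p v); exists 0 => /=.
Qed.

Lemma ray_inf_sublinear p v : sublinear p -> sublinear (ray_inf p v).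
Proof.
move=> sp; split=> [x y|a x a0].
  rewrite -lerBlDl; apply: ray_inf_ge => t t0.
  rewrite lerBlDl -lerBlDr; apply: ray_inf_ge => s s0.
  rewrite lerBlDr; apply: (le_trans (ray_inf_le v _ sp (addr_ge0 s0 t0))).
  by rewrite scalerDl addrACA mulrDl; have := sp.1 (x + s *: v) (y + t *: v); lra.
rewrite -ler_pdivrMl//; apply: ray_inf_ge => t t0.
rewrite ler_pdivrMl//.
apply: (le_trans (ray_inf_le v _ sp (mulr_ge0 (ltW a0) t0))).
by rewrite -scalerA -scalerDr sublinearZ ?(ltW a0)// mulrBr mulrA.
Qed.

(** Zorn is applied to functionals defined on the whole space, which avoids
    partial extensions: the pointwise infimum of a chain is finite because every
    q <= p satisfies - p (- x) <= q x. *)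
Lemma minimal_sublinear p : sublinear p ->
  exists2 q : V -> R, sublinear q /\ (forall x, q x <= p x) &
    forall r, sublinear r -> (forall x, r x <= q x) -> r = q.
Proof.
move=> sp.
pose T := {q : V -> R | sublinear q /\ forall x, q x <= p x}.
pose le (q r : T) := `[< forall x, sval r x <= sval q x >].
have [||||[q [sq qp]] qmin] := @Zorn T le.
- by move=> t; apply/asboolP.
- move=> r s t /asboolP rs /asboolP st; apply/asboolP => x.
  exact: (le_trans (st x)).
- move=> [s ?] [t ?] /asboolP/= st /asboolP/= ts; apply: eq_exist.
  by apply/funext => x; apply/le_anti; rewrite st ts.
- move=> A totA; have [->|/set0P[q0 Aq0]] := eqVneq A set0.
    by exists (exist _ p (conj sp (fun x => lexx _))) => s.
  have lbA x : has_lbound [set sval q x | q in A].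
    exists (- p (- x)) => _ [[q [sq qp]] Aq <-] /=.
    by apply: le_trans (sublinearN x sq); rewrite lerN2.
  pose m x := inf [set sval q x | q in A].
  have mle q x : A q -> m x <= sval q x by move=> Aq; apply: ge_inf => //; exists q.
  have mge c x : (forall q, A q -> c <= sval q x) -> c <= m x.
    move=> cle; apply: lb_le_inf; first by exists (sval q0 x); exists q0.
    by move=> _ [q Aq <-]; exact: cle.
  have sm : sublinear m.
    split=> [x y|a x a0].
      rewrite -lerBlDl; apply/mge => q Aq.
      rewrite lerBlDl -lerBlDr; apply/mge => r Ar.
      rewrite lerBlDr; have [/asboolP qr|/asboolP rq] := totA _ _ Aq Ar.
      + apply: (le_trans (mle r _ Ar)).
        by apply: (le_trans ((svalP r).1.1 x y)); rewrite lerD2l.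
      + apply: (le_trans (mle q _ Aq)).
        by apply: (le_trans ((svalP q).1.1 x y)); rewrite lerD2r.
    rewrite -ler_pdivrMl//; apply/mge => q Aq; rewrite ler_pdivrMl//.
    by apply: (le_trans (mle q _ Aq)); exact: (svalP q).1.2.
  have mp x : m x <= p x by apply: (le_trans (mle q0 x Aq0)); exact: (svalP q0).2.
  by exists (exist _ m (conj sm mp)) => s As; apply/asboolP => x /=; exact: mle.
exists q => // r sr rq; have rp x : r x <= p x := le_trans (rq x) (qp x).
have /= := qmin (exist _ r (conj sr rp)); rewrite /le/= => H.
by have /(congr1 sval) := H ltac:(by apply/asboolP).
Qed.

(** A minimal sublinear functional q equals all its [ray_inf q v], which is
    additivity; starting the minimization from [ray_inf p v] rather than p
    forces the value p v at v. *)
Lemma linear_minorant p v : sublinear p ->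
  exists phi : {linear V -> R^o}, (forall x, phi x <= p x) /\ phi v = p v.
Proof.
move=> sp; have [q [sq qle] qmin] := minimal_sublinear (ray_inf_sublinear v sp).
have ray_le r w x : sublinear r -> ray_inf r w x <= r x.
  by move=> sr; have := ray_inf_le w x sr (lexx 0); rewrite scale0r addr0 mul0r subr0.
have rayE w : ray_inf q w = q.
  by apply: qmin => [|z]; [exact: ray_inf_sublinear|exact: ray_le].
have qD x y : q (x + y) = q x + q y.
  apply/le_anti; rewrite sq.1 /=.
  have := ray_inf_le y x sq ler01; rewrite rayE scale1r mul1r; lra.
have qN x : q (- x) = - q x.
  by have := qD x (- x); rewrite subrr sublinear0//; lra.
have qlin : linear (q : V -> R^o).
  move=> a x y; rewrite qD; congr (_ + _).
  have [a0|a0] := leP 0 a; first exact: sublinearZ.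
  have -> : a *: x = - ((- a) *: x) by rewrite scaleNr opprK.
  by rewrite qN sublinearZ ?oppr_ge0 1?ltW// mulNr opprK.
pose L := GRing.isLinear.Build R V R^o _ (q : V -> R^o) qlin.
pose phi : {linear V -> R^o} := HB.pack (q : V -> R^o) L.
exists phi; split=> [x|].
  by apply: (le_trans (qle x)); exact: ray_le.
apply/le_anti; rewrite (le_trans (qle v) (ray_le _ _ _ sp))/=.
have := qle (- v); rewrite qN => /le_trans/(_ (ray_inf_le v (- v) sp ler01)).
by rewrite scale1r mul1r addNr sublinear0// sub0r lerN2.
Qed.

(** The linear form is a minorant of the Minkowski gauge of C that agrees with it
    at p, where the gauge is at least 1. No topology is involved: C only has 0
    in its algebraic interior. *)
Lemma gauge_separation (C : set V) p :
  (forall x y (t : R), C x -> C y -> 0 <= t -> t <= 1 -> C (t *: x + (1 - t) *: y)) ->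
  (forall v, exists2 s : R, 0 < s & C (s *: v)) -> ~ C p ->
  exists phi : {linear V -> R^o}, (forall c, C c -> phi c <= 1) /\ 1 <= phi p.
Proof.
move=> cC absC Cp.
have C0 : C 0 by have [s _] := absC 0; rewrite scaler0.
pose G v := [set t | 0 < t /\ C (t^-1 *: v)].
pose g v := inf (G v).
have Glb v : has_lbound (G v) by exists 0 => t [/ltW].
have G0 v : G v !=set0.
  by have [s s0 Cs] := absC v; exists s^-1; rewrite /G/= invr_gt0 invrK.
have gle v t : 0 < t -> C (t^-1 *: v) -> g v <= t.
  by move=> t0 Ct; apply: ge_inf.
have gge v m : (forall t, 0 < t -> C (t^-1 *: v) -> m <= t) -> m <= g v.
  by move=> mle; apply: lb_le_inf => // t [t0 Ct]; exact: mle.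
have sg : sublinear g.
  split=> [x y|a x a0].
    rewrite -lerBlDl; apply/gge => t t0 Ct; rewrite lerBlDl -lerBlDr.
    apply/gge => s s0 Cs; rewrite lerBlDr; apply/gle; first exact: addr_gt0.
    have st0 : 0 < s + t by exact: addr_gt0.
    have -> : (s + t)^-1 *: (x + y) =
      (s / (s + t)) *: (s^-1 *: x) + (1 - s / (s + t)) *: (t^-1 *: y).
      by rewrite !scalerA scalerDr; congr (_ *: _ + _ *: _); field; lra.
    apply/cC => //; first by rewrite divr_ge0// ltW.
    by rewrite ler_pdivrMr// mul1r lerDl ltW.
  rewrite -ler_pdivrMl//; apply/gge => t t0 Ct; rewrite ler_pdivrMl//.
  apply/gle; first exact: mulr_gt0.
  by rewrite scalerA invfM mulrAC mulVf ?gt_eqF// mul1r.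
have [phi [phile phip]] := linear_minorant p sg; exists phi; split.
  move=> c Cc; apply: (le_trans (phile c)); apply/gle => //.
  by rewrite invr1 scale1r.
rewrite phip; apply/gge => t t0 Ct; rewrite leNgt; apply/negP => t1.
apply: Cp; have := cC _ _ t Ct C0 (ltW t0) (ltW t1).
by rewrite scaler0 addr0 scalerA mulfV ?gt_eqF// scale1r.
Qed.

End HahnBanach.

(** * Separation in finite dimension and continuous linear forms *)

Section FiniteSeparation.
Context {R : realType}.

Lemma convex_setP {V : lmodType R} (C : set V) : convex_set C <->
  forall x y (t : R), C x -> C y -> 0 <= t -> t <= 1 -> C (t *: x + (1 - t) *: y).
Proof.
split=> [cC x y t Cx Cy t0 t1|cC x y t].
  have t01 : Itv.spec (@Itv.num_sem R) (Itv.Real `[0%Z, 1%Z]) t.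
    by rewrite /= /Itv.num_sem/= in_itv/= t0 t1 num_real.
  by have := cC x y (Itv.mk t01); rewrite !inE; exact.
rewrite !inE => Cx Cy; apply: cC => //.
Qed.

(** Finite-dimensional strict separation of 0 from C, when the box of radius e
    around 0 avoids C. The set C is translated and thickened by the box, so that it
    becomes absorbing; the form obtained is bounded below on C by its values on
    the box. *)
Lemma row_separation n (C : set 'rV[R]_n) (e : R) : 0 < e -> convex_set C ->
  (forall c, C c -> exists i, e <= `|c 0 i|) ->
  exists (lam : 'I_n -> R) (d : R), 0 < d /\
    forall c, C c -> d <= \sum_i lam i * c 0 i.
Proof.
move=> e0 /convex_setP cC Ce.
have [->|/set0P[c0 Cc0]] := eqVneq C set0.
  by exists (fun=> 0), 1; split.
(* M v scales v into the open box. *)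
pose M (v : 'rV[R]_n) := e / (1 + \sum_i `|v 0 i|).
have S0 (v : 'rV[R]_n) : 0 <= \sum_i `|v 0 i| by apply: sumr_ge0.
have M0 v : 0 < M v by rewrite divr_gt0//; have := S0 v; lra.
have Me v i : `|(M v *: v) 0 i| < e.
  rewrite mxE normrM gtr0_norm// /M mulrAC ltr_pdivrMr; last first.
    by have := S0 v; lra.
  rewrite ltr_pM2l// (bigD1 i)//=.
  have : 0 <= \sum_(j | j != i) `|v 0 j| by apply: sumr_ge0.
  lra.
(* c0 lies in D only if C meets the open box of radius e. *)
pose D := [set c0 - c + q | c in C
  & q in [set q : 'rV[R]_n | forall i, `|q 0 i| < e]].
have [|||phi [phiD phic0]] := @gauge_separation R 'rV[R]_n D c0.
- move=> _ _ t [c Cc [q /= qe <-]] [c' Cc' [q' /= qe' <-]] t0 t1.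
  exists (t *: c + (1 - t) *: c'); first exact: cC.
  exists (t *: q + (1 - t) *: q').
    move=> i; rewrite !mxE; apply: (le_lt_trans (ler_normD _ _)).
    rewrite !normrM ger0_norm// [`|1 - t|]ger0_norm ?subr_ge0//.
    have [->|tn0] := eqVneq t 0; first by rewrite mul0r add0r subr0 mul1r qe'.
    have : t * `|q 0 i| < t * e by rewrite ltr_pM2l ?qe// lt_neqAle eq_sym tn0.
    have : (1 - t) * `|q' 0 i| <= (1 - t) * e by rewrite ler_wpM2l ?subr_ge0// ltW ?qe'.
    lra.
  apply/rowP => i; rewrite !mxE; ring.
- move=> v; exists (M v) => //; exists c0 => //; exists (M v *: v).
    exact: Me.
  by rewrite subrr add0r.
- move=> [c Cc [q qe /rowP cq]]; have [i] := Ce c Cc.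
  suff -> : c 0 i = q 0 i by rewrite leNgt qe.
  by have := cq i; rewrite !mxE; lra.
exists (fun i => phi (delta_mx 0 i)), (M c0); split => // c Cc.
have -> : \sum_i phi (delta_mx 0 i) * c 0 i = phi c.
  rewrite [in RHS](row_sum_delta c) linear_sum; apply: eq_bigr => i _.
  by rewrite linearZ/= mulrC.
have /phiD : D (c0 - c + M c0 *: c0).
  by exists c => //; exists (M c0 *: c0) => // i; exact: Me.
rewrite linearD linearB linearZ/= => H.
have : M c0 * 1 <= M c0 * phi c0 by rewrite ler_pM2l.
have -> : M c0 * phi c0 = M c0 *: phi c0 by [].
lra.
Qed.
End FiniteSeparation.

Section Dual.
Context {R : realType} {X : tvsType R}.

Lemma dual_linear (u : dual X) : linear u.
Proof. by have := dual_valP u; rewrite inE => -[]. Qed.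

HB.instance Definition _ (u : dual X) :=
  GRing.isLinear.Build R X R^o _ (dual_val u) (dual_linear u).

Lemma dual_continuous (u : dual X) : continuous u.
Proof. by have := dual_valP u; rewrite inE => -[]. Qed.

Lemma convex_nbhs0 (U : set X) : nbhs 0 U ->
  exists V : set X, [/\ nbhs 0 V, convex_set V & V `<=` U].
Proof.
move=> U0; have [B cB [oB /(_ 0 U U0)[V [BV V0] VU]]] := @locally_convex R X.
exists V; split => //; last by apply: cB; rewrite inE.
by apply: open_nbhs_nbhs; split => //; exact: oB.
Qed.


Lemma tvs_cvgD {I : Type} {F : set_system I} {FF : Filter F} (f g : I -> X) a b :
  f i @[i --> F] --> a -> g i @[i --> F] --> b -> f i + g i @[i --> F] --> a + b.
Proof.
by move=> fa gb; apply: continuous2_cvg fa gb; exact: (@add_continuous X (a, b)).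
Qed.

Lemma tvs_cvgZ {I : Type} {F : set_system I} {FF : Filter F} (s : I -> R) (f : I -> X)
    (k : R) a :
  s i @[i --> F] --> k -> f i @[i --> F] --> a -> s i *: f i @[i --> F] --> k *: a.
Proof.
by move=> sk fa; apply: continuous2_cvg sk fa; exact: (@scale_continuous R X (k, a)).
Qed.

Lemma nbhs0_absorbing (U : set X) v : nbhs 0 U -> exists2 s : R, 0 < s & U (s *: v).
Proof.
move=> U0.
have : (s *: v) @[s --> (0 : R)^'+] --> (0 : X).
  rewrite -[X in _ --> X](scale0r v); apply: tvs_cvgZ; last exact: cvg_cst.
  exact: cvg_at_right_filter.
move=> /(_ U U0) Us; near (0 : R)^'+ => s; exists s; first by [].
by near: s; exact: Us.
Unshelve. all: by end_near. Qed.

(** A linear form that is bounded above on a neighbourhood of 0 is continuous,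
    which turns the forms produced by separation into elements of the dual. *)
Lemma dual_of_bounded (phi : {linear X -> R^o}) (V : set X) (m : R) : nbhs 0 V ->
  (forall v, V v -> phi v <= m) -> exists u : dual X, u =1 phi.
Proof.
move=> V0 phiV; suff cphi : continuous phi.
  have phiP : (phi : X -> R^o) \in continuous_linear.
    by rewrite inE; split=> //; exact: linearP.
  by exists (Dual phiP).
move=> x; apply/cvgrPdist_lt => e e0.
have m0 : 0 <= m by rewrite -(linear0 phi); apply: phiV; exact: nbhs_singleton.
pose k := 2 * (m + 1) / e.
have k0 : 0 < k by rewrite divr_gt0// mulr_gt0//; lra.
have near1 (a : R) : \forall y \near x, V (a *: (y - x)).
  have : a *: (y - x) @[y --> x] --> (0 : X).
    rewrite -[X in _ --> X](scaler0 _ a) -(subrr x).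
    apply: tvs_cvgZ; first exact: cvg_cst.
    by apply: tvs_cvgD; [exact: cvg_id|exact: cvg_cst].
  exact.
near=> y; rewrite -linearB ltr_norml.
have H1 : phi (k *: (y - x)) <= m by apply: phiV; near: y; exact: near1.
have H2 : phi (- k *: (y - x)) <= m by apply: phiV; near: y; exact: near1.
have phiZ a z : phi (a *: z) = a * phi z by rewrite linearZ.
move: H1 H2; rewrite !phiZ -[y - x]opprB linearN/=.
set z : R := phi (x - y); rewrite !mulrN mulNr opprK => H1 H2.
have km : m < k * e by rewrite /k mulfVK ?gt_eqF//; lra.
by rewrite -(ltr_pM2l k0) -[X in _ && X](ltr_pM2l k0) mulrN; lra.
Unshelve. all: by end_near. Qed.

Lemma dual_separates (y : X) : hausdorff_space X -> y <> 0 ->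
  exists u : dual X, u y != 0.
Proof.
move=> hX y0.
have [U U0 Uy] : exists2 U : set X, nbhs 0 U & ~ U y.
  apply: contrapT => /forall2NP H; apply: y0; apply: hX => A B Ay B0.
  exists y; split; first exact: nbhs_singleton.
  by have [|/contrapT] := H B.
have [V [V0 cV VU]] := convex_nbhs0 U0.
have [||phi [phiV phiy]] := @gauge_separation R X V y ((convex_setP V).1 cV).
- by move=> v; exact: nbhs0_absorbing.
- by move=> /VU.
have [u uphi] := dual_of_bounded V0 phiV.
by exists u; rewrite uphi gt_eqF//; apply: lt_le_trans phiy.
Qed.
End Dual.

(** * Lower semicontinuous envelopes and epsilon-subgradients *)

Section Envelope.
Context {R : realType} {X : tvsType R}.
Implicit Types f g : X -> \bar R.

Lemma convex_efunP f : convex_efun f <->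
  forall y z (a b t : R), (f y <= a%:E)%E -> (f z <= b%:E)%E -> 0 <= t -> t <= 1 ->
    (f (t *: y + (1 - t) *: z)%R <= (t * a + (1 - t) * b)%:E)%E.
Proof.
rewrite /convex_efun convex_setP; split=> cf.
  by move=> y z a b t fy fz; exact: (cf (y, a) (z, b) t fy fz).
by move=> [y a] [z b] t fy fz; exact: cf.
Qed.

Lemma lsc_envelope_le f y : (lsc_envelope f y <= f y)%E.
Proof. by apply: ge_ereal_sup => _ [g [_ gf] <-]. Qed.

Lemma lsc_envelope_ge f g y : lower_semicontinuous g -> (forall z, (g z <= f z)%E) ->
  (g y <= lsc_envelope f y)%E.
Proof. by move=> lg gf; apply: ereal_sup_ubound; exists g. Qed.

Lemma lsc_envelope_lsc f : lower_semicontinuous (lsc_envelope f).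
Proof.
move=> y a /ereal_sup_gt[_ [g [lg gf] <-]] /lg[V Vy aV]; exists V => // z Vz.
by apply: (lt_le_trans (aV z Vz)); exact: lsc_envelope_ge.
Qed.

(** The infimum of f over each neighbourhood of y is at most the envelope at y:
    otherwise the function equal to a on an open neighbourhood and -oo elsewhere
    would be a semicontinuous minorant of f with a larger value at y. *)
Lemma lsc_envelope_lt f y (a : R) (U : set X) : (lsc_envelope f y < a%:E)%E ->
  nbhs y U -> exists2 z, U z & (f z < a%:E)%E.
Proof.
move=> fya; rewrite nbhsE => -[W [oW Wy] WU]; apply: contrapT => /forall2NP H.
move: fya; apply/negP; rewrite -leNgt.
pose g z := if z \in W then a%:E else -oo%E.
have -> : a%:E = g y by rewrite /g mem_set.
apply: lsc_envelope_ge => [z b|z]; rewrite /g; case: ifPn => [/set_mem Wz|_].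
- move=> ba; exists W; first exact: open_nbhs_nbhs.
  by move=> w Ww; rewrite mem_set.
- by rewrite ltNge leNye.
- rewrite leNgt; have [|/negP//] := H z; by move=> /(_ (WU _ Wz)).
- exact: leNye.
Qed.

Lemma lsc_envelope_convex f : convex_efun f -> convex_efun (lsc_envelope f).
Proof.
move=> /convex_efunP cf; apply/convex_efunP => y z a b t fy fz t0 t1.
rewrite leNgt; apply/negP.
set c := t * a + (1 - t) * b; set w := t *: y + _ => cw.
have [d d0 cdw] : exists2 d : R, 0 < d & ((c + d)%:E < lsc_envelope f w)%E.
  case E : (lsc_envelope f w) cw => [r| |]//.
    by rewrite lte_fin => cr; exists ((r - c) / 2); rewrite ?lte_fin; lra.
  by exists 1; rewrite // ltry.
have [V Vw dV] := lsc_envelope_lsc cdw.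
have : t *: p.1 + (1 - t) *: p.2 @[p --> filter_prod (nbhs y) (nbhs z)] --> w.
  apply: tvs_cvgD; apply: tvs_cvgZ; try exact: cvg_cst.
    exact: cvg_fst.
  exact: cvg_snd.
move=> /(_ V Vw)[[A B] /= [Ay Bz] AB].
have [y' Ay' fy'] : exists2 y', A y' & (f y' < (a + d)%:E)%E.
  by apply: lsc_envelope_lt Ay; apply: (le_lt_trans fy); rewrite lte_fin; lra.
have [z' Bz' fz'] : exists2 z', B z' & (f z' < (b + d)%:E)%E.
  by apply: lsc_envelope_lt Bz; apply: (le_lt_trans fz); rewrite lte_fin; lra.
have /= Vw' := AB (y', z') (conj Ay' Bz').
have := cf y' z' (a + d) (b + d) t (ltW fy') (ltW fz') t0 t1.
apply/negP; rewrite -ltNge; have -> : t * (a + d) + (1 - t) * (b + d) = c + d.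
  by rewrite /c; ring.
by apply: (lt_le_trans (dV _ Vw')); exact: lsc_envelope_le.
Qed.

End Envelope.

Section EpsSubgradient.
Context {R : realType} {X : tvsType R}.

Lemma ler_mix (t a b a' b' : R) : 0 <= t -> t <= 1 -> a <= a' -> b <= b' ->
  t * a + (1 - t) * b <= t * a' + (1 - t) * b'.
Proof. by move=> t0 t1 aa' bb'; rewrite lerD// ler_wpM2l// subr_ge0. Qed.

(** Semicontinuity alone gives a neighbourhood for each s; compactness of the
    segment makes it uniform in s, and provides the room needed to
    separate the segment from the epigraph of g. *)
Lemma lsc_ray_nbhs (g : X -> \bar R) x z (r k eps S : R) :
  lower_semicontinuous g -> 0 < eps ->
  (forall s : R, 0 <= s -> ((r + s * k)%:E <= g (x + s *: z)%R)%E) ->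
  \forall v \near (0 : X), forall s : R, 0 <= s <= S ->
    ((r + s * k - eps)%:E < g (x + s *: z + v)%R)%E.
Proof.
move=> lg eps0 gle.
have /compact_near_coveringP cov := @segment_compact R 0 S.
have H : \forall v \near (0 : X), `[0, S]%classic `<=`
    (fun s => (r + s * k - eps)%:E < g (x + s *: z + v)%R)%E.
  apply: (cov X (nbhs (0 : X))
    (fun v s => (r + s * k - eps)%:E < g (x + s *: z + v)%R)%E _) => s /=.
  rewrite in_itv/= => /andP[s0 sS].
  have [|V Vxs gV] := lg (x + s *: z) (r + s * k - eps / 2).
    by apply: lt_le_trans (gle s s0); rewrite lte_fin; lra.
  have c1 : x + p.1 *: z + p.2 @[p --> filter_prod (nbhs s) (nbhs (0 : X))]
      --> x + s *: z.
    rewrite -[X in _ --> X]addr0; apply: tvs_cvgD; last exact: cvg_snd.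
    apply: tvs_cvgD; first exact: cvg_cst.
    by apply: tvs_cvgZ; [exact: cvg_fst|exact: cvg_cst].
  have c2 : \forall p \near filter_prod (nbhs s) (nbhs (0 : X)),
      p.1 * k < s * k + eps / 2.
    have : p.1 * k @[p --> filter_prod (nbhs s) (nbhs (0 : X))] --> s * k.
      by apply: cvgM; [exact: cvg_fst|exact: cvg_cst].
    by move=> /cvgr_lt; apply; lra.
  have c1V : filter_prod (nbhs s) (nbhs (0 : X)) _ := c1 V Vxs.
  change (filter_prod (nbhs s) (nbhs (0 : X))
    [set p : R * X | ((r + p.1 * k - eps)%:E < g (x + p.1 *: z + p.2)%R)%E]).
  apply: filterS (filterI c1V c2) => -[s' v]/= [/gV gs' s'k].
  by apply: le_lt_trans gs'; rewrite lee_fin; lra.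
by apply: filterS H => v Hv s s0S; apply: Hv; rewrite /= in_itv.
Qed.

(** The epigraph of g is separated from the points lying at least eps below
    the line s |-> g x + s k over a neighbourhood of the segment from x to
    x + S z. The bound at s = 0 says that the form is an eps-subgradient; the bound
    at s = S says that its slope along z is at least k - eps / S, and
    S = eps / del. *)
Lemma esubdiff_slope (g : X -> \bar R) x z (eps del k : R) :
  lower_semicontinuous g -> convex_efun g -> g x \is a fin_num ->
  0 < eps -> 0 < del ->
  (forall s : R, 0 <= s -> (g x + (s * k)%:E <= g (x + s *: z)%R)%E) ->
  exists2 u : dual X, esubdiff eps g x u & k - del <= u z.
Proof.
move=> lg /convex_efunP cg gfin eps0 del0.
have gx := fineK gfin; set r := fine (g x) in gx; rewrite -gx => gle.
pose S := eps / del; have S0 : 0 < S by exact: divr_gt0.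
have := lsc_ray_nbhs S lg eps0 gle.
move=> /convex_nbhs0[V [V0 /convex_setP cV gV]].
(* Differences between points under the thickened segment and points of the
   epigraph, raised by 1 + eps so that 0 becomes interior. The point (0, 1 + eps)
   would be the difference of two equal points. *)
pose C (p : X * R^o) := exists y (q s : R) v, [/\ (g y <= q%:E)%E, 0 <= s <= S, V v,
  p.1 = x + s *: z + v - y & p.2 <= 1 + r + s * k - q].
have Vz : V 0 := nbhs_singleton V0.
have Cx (w : X) (rho : R) : V w -> rho <= 1 -> C (w, rho).
  move=> Vw rho1; exists x, r, 0, w; split => //=; rewrite ?gx ?lexx ?(ltW S0)//.
    by rewrite scale0r addr0 addrAC subrr add0r.
  rewrite mul0r addr0 addrK; exact: rho1.
have [|||phi [phiC phi1]] := @gauge_separation R (X * R^o)%type C (0, 1 + eps).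
- move=> [w1 rho1] [w2 rho2] t [y1 [q1 [s1 [v1 [gy1 /andP[s10 s1S] Vv1 /= -> le1]]]]].
  move=> [y2 [q2 [s2 [v2 [gy2 /andP[s20 s2S] Vv2 /= -> le2]]]]] t0 t1.
  have t10 : 0 <= 1 - t by lra.
  exists (t *: y1 + (1 - t) *: y2), (t * q1 + (1 - t) * q2),
    (t * s1 + (1 - t) * s2), (t *: v1 + (1 - t) *: v2); split => /=.
  + exact: cg.
  + rewrite addr_ge0 ?mulr_ge0//=.
    by apply: le_trans (ler_mix t0 t1 s1S s2S) _; rewrite -mulrDl addrC subrK mul1r.
  + exact: cV.
  + rewrite !scalerDr !scalerN addrACA [X in X + _]addrACA [X in X + _ + _]addrACA.
    by rewrite -opprD -scalerDl subrKC scale1r !scalerA -scalerDl.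
  + apply: le_trans (ler_mix t0 t1 le1 le2) _.
    by rewrite le_eqVlt; apply/orP; left; apply/eqP; ring.
- move=> p; have : nbhs (0 : X * R^o) [set p | V p.1 /\ p.2 <= 1].
    exists (V, [set a : R^o | a <= 1]) => //; split => //=.
    apply: filterS (@nbhs0_lt R R^o 1 ltr01) => a /= /ltW.
    exact: le_trans (ler_norm a).
  move=> /(nbhs0_absorbing p)[s s0 [Vs sp]]; exists s => //.
  by rewrite [s *: p]surjective_pairing; exact: Cx.
- move=> [y [q [s [v [gy sS Vv /= Hy Hq]]]]].
  have {Hy} yE : y = x + s *: z + v by apply/eqP; rewrite -subr_eq0 -oppr_eq0 opprB -Hy.
  have := lt_le_trans (gV v Vv s sS); rewrite -yE => /(_ _ gy).
  rewrite lte_fin; lra.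
pose b : R := phi (0, 1).
have phiE w (rho : R) : phi (w, rho) = phi (w, 0) + rho * b.
  have -> : (w, rho) = (w, 0) + rho *: ((0, 1) : X * R^o).
    congr pair => /=; rewrite ?scaler0 ?addr0//.
    by rewrite add0r; change (rho = rho * 1); rewrite mulr1.
  by rewrite linearD linearZ.
have b1 : 1 <= (1 + eps) * b by move: phi1; rewrite phiE (_ : (0, 0) = 0)// linear0 add0r.
have b0 : 0 < b by rewrite -(pmulr_rgt0 _ (_ : 0 < 1 + eps)); lra.
have lpsi : linear (fun w => phi (w, 0) : R^o).
  move=> a w w'; rewrite -linearP; congr (phi (_, _)).
  by rewrite /= scaler0 addr0.
pose psi : {linear X -> R^o} := HB.pack (fun w => phi (w, 0) : R^o)
  (GRing.isLinear.Build R X R^o _ _ lpsi).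
have psiC y q s v : (g y <= q%:E)%E -> 0 <= s <= S -> V v ->
    psi (x + s *: z + v - y) + (r + s * k - q) * b <= eps * b.
  move=> gy sS Vv.
  have /phiC : C (x + s *: z + v - y, 1 + r + s * k - q) by exists y, q, s, v.
  rewrite phiE -[phi (_, 0)]/(psi _); lra.
have [u1 u1E] : exists u : dual X, u =1 psi.
  apply: (dual_of_bounded (m := eps * b) V0) => v Vv.
  have := psiC x r 0 v; rewrite gx lexx !lexx ltW//= scale0r addr0 mul0r addr0 subrr.
  by rewrite mul0r addr0 addrAC subrr add0r; exact.
have uE w : ((- b^-1) *: u1) w = - (psi w / b).
  change ((- b^-1) *: u1 w = - (psi w / b)).
  change ((- b^-1) * u1 w = - (psi w / b)).
  by rewrite u1E mulNr mulrC.
exists ((- b^-1) *: u1).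
  split=> // y; rewrite uE.
  have psiN : psi (y - x) = - psi (x - y) by rewrite -[y - x]opprB linearN.
  have key q : (g y <= q%:E)%E -> - (psi (y - x) / b) - eps <= q - r.
    move=> gy; have := psiC y q 0 0 gy; rewrite lexx ltW// scale0r !addr0 mul0r addr0.
    move=> /(_ isT Vz) H; rewrite -(ler_pM2r b0) mulrBl mulNr mulfVK ?gt_eqF//.
    by rewrite psiN opprK mulrBl in H *; lra.
  case E : (g y) => [q| |]; rewrite -gx/= ?leey//.
    by rewrite lee_fin; apply: key; rewrite E.
  (* The value -oo is impossible: [key] would hold for every q. *)
  have := key (r - (psi (y - x) / b) - eps - 1).
  by rewrite E leNye => /(_ isT) ?; exfalso; lra.
rewrite uE.
(* At the far end of the segment the bound on the slope is eps / S = del. *)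
have := psiC x r S 0; rewrite gx !lexx (ltW S0) => /(_ isT isT Vz).
have -> : x + S *: z + 0 - x = S *: z by rewrite addr0 addrAC subrr add0r.
have -> : r + S * k - r = S * k by ring.
have -> : psi (S *: z) = S * psi z by rewrite linearZ.
have -> : eps * b = S * (del * b) by rewrite mulrA /S divfK ?gt_eqF.
rewrite -mulrA -mulrDr ler_pM2l// => H.
by rewrite -(ler_pM2r b0) mulrBl mulNr mulfVK ?gt_eqF//; lra.
Qed.
End EpsSubgradient.

(** * Slopes reached by the active functions *)

Section Compactness.
Context {R : realType} {X : tvsType R}.

Lemma convex_ray (g : X -> \bar R) x z (a b s s1 : R) : convex_efun g ->
  (g x <= a%:E)%E -> (g (x + s1 *: z)%R <= b%:E)%E -> 0 < s1 -> 0 <= s <= s1 ->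
  (g (x + s *: z)%R <= (a + s / s1 * (b - a))%:E)%E.
Proof.
move=> /convex_efunP cg ga gb s10 /andP[s0 ss1].
have := cg (x + s1 *: z) x b a (s / s1) gb ga (divr_ge0 s0 (ltW s10)).
rewrite ler_pdivrMr// mul1r => /(_ ss1).
have -> : (s / s1) *: (x + s1 *: z) + (1 - s / s1) *: x = x + s *: z.
  rewrite scalerDr addrAC -scalerDl subrKC scale1r scalerA.
  by rewrite divfK ?gt_eqF.
by have -> : s / s1 * b + (1 - s / s1) * a = a + s / s1 * (b - a) by ring.
Qed.

(** The term s * s leaves a positive margin that shrinks with s; a single
    parameter then controls both the step along the ray and the strictness of
    the inequality, so that strictness survives suprema over the indices. *)
Lemma near_slope (a r K : R) : a < r ->
  \forall s \near (0 : R)^'+, a + s * K <= r - s * s.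
Proof.
move=> ar; pose M := `|K| + 1.
have M0 : 0 < M by rewrite ltr_wpDl.
near=> s.
have s0 : 0 < s by near: s; exact: nbhs_right_gt.
have s1 : s <= 1 by near: s; exact: nbhs_right_le.
have : s <= (r - a) / M by near: s; apply: nbhs_right_le; rewrite divr_gt0// subr_gt0.
rewrite ler_pdivlMr// /M mulrDr mulr1.
have := ler_wpM2l (ltW s0) (ler_norm K); have := ler_wpM2l (ltW s0) s1.
by rewrite mulr1; lra.
Unshelve. all: by end_near. Qed.

Lemma usc_on_near (T : topologicalType) (A : set T) (h : T -> \bar R) t (a : R) :
  usc_on A h -> A t -> (h t < a%:E)%E -> \forall t' \near t, A t' -> (h t' < a%:E)%E.
Proof.
move=> uh At hta; have [|V Vt hV] := uh t (- a).
  by rewrite EFinN lteN2.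
have [W Wt WV] := (@nbhs_subspace_ex T A V t At).1 Vt.
apply: filterS Wt => t' Wt' At'; rewrite -lteN2 -EFinN; apply: hV.
by have [] : (V `&` A) t' by rewrite WV.
Qed.

Lemma affine_lsc (u : dual X) x (r : R) :
  lower_semicontinuous (fun y => (r + u (y - x))%:E : \bar R).
Proof.
move=> y a; rewrite lte_fin => ay.
have c : r + u (w - x) @[w --> y] --> r + u (y - x).
  apply: cvgD; first exact: cvg_cst.
  apply: continuous_cvg; first exact: dual_continuous.
  by apply: tvs_cvgD; [exact: cvg_id|exact: cvg_cst].
exists [set w | a < r + u (w - x)]; last by move=> w /=; rewrite lte_fin.
by move: c => /cvgr_gt; exact.
Qed.

Lemma lte_between (h : \bar R) (c : R) : (h < c%:E)%E ->
  exists2 b : R, (h <= b%:E)%E & b < c.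
Proof.
case: h => [b| |]//; first by rewrite lte_fin => bc; exists b.
by exists (c - 1); [rewrite leNye|lra].
Qed.

Context {T : topologicalType}.

(** See the introduction. The conclusion is about f_t and not its envelope: when
    cl f_t agrees with f at x, so does f_t, and the eps-subgradients of cl f_t
    at x are eps-subgradients of f_t. *)
Lemma slope_active (f_ : T -> X -> \bar R) x (e0 : R) (u0 : dual X) z (s0 eps del : R) :
  (forall t, convex_efun (f_ t)) ->
  lsc_envelope (sup_fun f_) = sup_fun (fun t => lsc_envelope (f_ t)) ->
  0 < e0 -> compact (eactive f_ e0 x) ->
  (forall z, edom (lsc_envelope (sup_fun f_)) z ->
     usc_on (eactive f_ e0 x) (fun t => lsc_envelope (f_ t) z)) ->
  subdiff (sup_fun f_) x u0 -> 0 < s0 -> edom (sup_fun f_) (x + s0 *: z) ->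
  0 < eps -> 0 < del ->
  exists t, active f_ x t /\ exists2 a, esubdiff eps (f_ t) x a & u0 z - del <= a z.
Proof.
move=> cf clsup e00 kE uscE [fxfin u0f] s00 fs0 eps0 del0.
set f := sup_fun f_ in clsup fxfin u0f fs0 *.
pose g t := lsc_envelope (f_ t); pose k := u0 z.
have cg t : convex_efun (g t) by exact: lsc_envelope_convex.
have fx := fineK fxfin; set r := fine (f x) in fx.
have le_f y : ((r + u0 (y - x))%:E <= f y)%E.
  by have := u0f y; rewrite subr0 -fx leeBrDl// -EFinD.
have le_cl y : ((r + u0 (y - x))%:E <= lsc_envelope f y)%E.
  apply: (lsc_envelope_ge (g := fun y => (r + u0 (y - x))%:E)) => //.
  exact: affine_lsc.
have g_cl t y : (g t y <= lsc_envelope f y)%E.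
  by rewrite clsup; apply: ereal_sup_ubound; exists t.
have clx : (lsc_envelope f x <= r%:E)%E by rewrite fx; exact: lsc_envelope_le.
have gx t : (g t x <= r%:E)%E := le_trans (g_cl t x) clx.
have [M fM] : exists M : R, (lsc_envelope f (x + s0 *: z)%R <= M%:E)%E.
  have := le_lt_trans (lsc_envelope_le f _) fs0.
  case: (lsc_envelope f _) => [M| |]// _; first by exists M.
  by exists 0; exact: leNye.
have cl_dom s : 0 <= s <= s0 -> edom (lsc_envelope f) (x + s *: z).
  move=> ss0; apply: le_lt_trans (ltry (r + s / s0 * (M - r))).
  rewrite clsup; apply: ge_ereal_sup => _ [t _ <-].
  exact: (convex_ray (cg t) (gx t) (le_trans (g_cl _ _) fM) s00 ss0).
apply: contrapT => noslope.
have desc t : eactive f_ e0 x t ->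
    exists2 s, 0 < s <= s0 & (g t (x + s *: z)%R < (r + s * k)%:E)%E.
  move=> Et; have [gxr|/eqP gxr] := eqVneq (g t x) r%:E.
    have ftx : f_ t x = r%:E.
      apply/le_anti/andP; split; last by rewrite -gxr; exact: lsc_envelope_le.
      by rewrite fx; apply: ereal_sup_ubound; exists t.
    (* Otherwise [esubdiff_slope] would give a slope excluded by [noslope]. *)
    have [s1 s10 gs1] : exists2 s, 0 < s & (g t (x + s *: z)%R < (r + s * k)%:E)%E.
      apply: contrapT => /forall2NP H; apply: noslope; exists t; split.
        by rewrite /active/= ftx fx.
      have [||||||a [agfin ag] az] := @esubdiff_slope R X (g t) x z eps del k => //.
      - exact: lsc_envelope_lsc.
      - by rewrite gxr.
      - move=> s; rewrite le_eqVlt => /orP[/eqP <-|s1].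
          by rewrite mul0r adde0 scale0r addr0.
        by rewrite gxr -EFinD leNgt; apply/negP; have [] := H s.
      exists a => //; split; first by rewrite ftx.
      move=> y; apply: (le_trans (ag y)); rewrite gxr ftx leeB//.
      exact: lsc_envelope_le.
    have [b gb bk] := lte_between gs1.
    pose s := Num.min s1 s0; have s_gt0 : 0 < s by rewrite lt_min s10.
    exists s; first by rewrite s_gt0 ge_min lexx orbT.
    have := convex_ray (cg t) (gx t) gb s10 (s := s).
    rewrite (ltW s_gt0) ge_min lexx => /(_ isT) /le_lt_trans; apply.
    rewrite lte_fin ltrD2l mulrAC -mulrA ltr_pM2l// ltr_pdivrMr//; lra.
  have gxlt : (g t x < r%:E)%E by rewrite lt_neqAle gx andbT; exact/eqP.
  have [a ga ar] := lte_between gxlt.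
  have gM : (g t (x + s0 *: z)%R <= M%:E)%E := le_trans (g_cl _ _) fM.
  near (0 : R)^'+ => s.
  have s_gt0 : 0 < s by near: s; exact: nbhs_right_gt.
  have ss0 : s <= s0 by near: s; exact: nbhs_right_le.
  exists s; first by rewrite s_gt0.
  have := convex_ray (cg t) ga gM s00 (s := s).
  rewrite (ltW s_gt0) ss0 => /(_ isT) /le_lt_trans; apply.
  rewrite lte_fin.
  have : a + s * ((M - a) / s0 - k) <= r - s * s by near: s; exact: near_slope.
  rewrite mulrBr mulrA [s * _ / s0]mulrAC; have := mulr_gt0 s_gt0 s_gt0; lra.
have nearE : \forall s \near (0 : R)^'+,
    eactive f_ e0 x `<=` [set t | (g t (x + s *: z)%R <= (r + s * k - s * s)%:E)%E].
  move/compact_near_coveringP/near_covering_withinP: kE => kE.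
  apply: kE => t Et.
  have [s1 /andP[s10 s1s0] gs1] := desc t Et.
  have [b gb bk] := lte_between gs1.
  (* Semicontinuity keeps nearby indices below the level c at s1, and the
     distance from c to the line at s1 bounds the admissible s. *)
  have [c bc ck] : exists2 c, b < c & c < r + s1 * k.
    by exists ((b + (r + s1 * k)) / 2); lra.
  have s1dom := cl_dom s1; rewrite (ltW s10) s1s0 in s1dom.
  have near_t := usc_on_near (uscE _ (s1dom isT)) Et
    (le_lt_trans gb (_ : (b%:E < c%:E)%E)).
  have near_s : \forall s \near (0 : R)^'+, 0 < s <= s1 /\ s <= k + (r - c) / s1.
    have eta0 : 0 < k + (r - c) / s1.
      by rewrite -(pmulr_rgt0 _ s10) mulrDr mulrCA divff ?gt_eqF// mulr1; lra.
    near=> s; split; last by near: s; exact: nbhs_right_le.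
    by apply/andP; split; near: s; [exact: nbhs_right_gt|exact: nbhs_right_le].
  change (filter_prod (nbhs t) (0 : R)^'+ [set p : T * R | eactive f_ e0 x p.1 ->
     (g p.1 (x + p.2 *: z)%R <= (r + p.2 * k - p.2 * p.2)%:E)%E]).
  exists ([set t' | eactive f_ e0 x t' -> (g t' (x + s1 *: z)%R < c%:E)%E],
          [set s | 0 < s <= s1 /\ s <= k + (r - c) / s1]).
    split => //=; apply: near_t; by rewrite lte_fin.
  move=> [t' s] /= [gt' [/andP[s_gt0 ss1] sk]] Et'.
  have := convex_ray (cg t') (gx t') (ltW (gt' Et')) s10 (s := s).
  rewrite (ltW s_gt0) ss1 => /(_ isT) /le_trans; apply.
  rewrite lee_fin; have := ler_wpM2l (ltW s_gt0) sk.
  have -> : s * (k + (r - c) / s1) = s * k - s / s1 * (c - r) by ring.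
  lra.
have nearNE : \forall s \near (0 : R)^'+,
    ~` eactive f_ e0 x `<=` [set t | (g t (x + s *: z)%R <= (r + s * k - s * s)%:E)%E].
  near=> s => t /= nEt.
  have s_gt0 : 0 < s by near: s; exact: nbhs_right_gt.
  have ss0 : s <= s0 by near: s; exact: nbhs_right_le.
  have ga : (g t x <= (r - e0)%:E)%E.
    apply: (le_trans (lsc_envelope_le _ _)); apply: ltW.
    by rewrite ltNge; apply/negP => H; apply: nEt; rewrite /eactive/= -/f -fx -EFinB.
  have gM : (g t (x + s0 *: z)%R <= M%:E)%E := le_trans (g_cl _ _) fM.
  have := convex_ray (cg t) ga gM s00 (s := s).
  rewrite (ltW s_gt0) ss0 => /(_ isT) /le_trans; apply.
  rewrite lee_fin.
  have : r - e0 + s * ((M - (r - e0)) / s0 - k) <= r - s * s.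
    by near: s; apply: near_slope; lra.
  rewrite mulrBr mulrA [s * _ / s0]mulrAC; lra.
near (0 : R)^'+ => s.
have s_gt0 : 0 < s by near: s; exact: nbhs_right_gt.
have : (lsc_envelope f (x + s *: z)%R <= (r + s * k - s * s)%:E)%E.
  rewrite clsup; apply: ge_ereal_sup => _ [t _ <-].
  have [Et|nEt] := pselect (eactive f_ e0 x t).
    by move: t Et; near: s; exact: nearE.
  by move: t nEt; near: s; exact: nearNE.
apply/negP; rewrite -ltNge; apply: lt_le_trans (le_cl _).
rewrite lte_fin; have -> : u0 (x + s *: z - x) = s * k.
  by rewrite addrAC subrr add0r linearZ.
by have := mulr_gt0 s_gt0 s_gt0; lra.
Unshelve. all: by end_near.
Qed.
End Compactness.

(** * Polar of a finite-dimensional normal cone, weak* separation *)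

Section FeasibleDirections.
Context {R : realType} {X : tvsType R}.

Lemma dual_addE (u v : dual X) z : (u + v) z = u z + v z. Proof. by []. Qed.
Lemma dual_oppE (u : dual X) z : (- u) z = - u z. Proof. by []. Qed.
Lemma dual_scaleE (a : R) (u : dual X) z : (a *: u) z = a * u z. Proof. by []. Qed.
Lemma dual_sumE n (u : 'I_n -> dual X) z : (\sum_i u i) z = \sum_i u i z.
Proof. by apply: (big_morph (fun u : dual X => u z : R)). Qed.

Lemma dualB (u : dual X) v w : u (v - w) = u v - u w.
Proof. by rewrite linearB. Qed.

Lemma dualD (u : dual X) v w : u (v + w) = u v + u w.
Proof. by rewrite linearD. Qed.

Lemma dual0 (u : dual X) : u 0 = 0.
Proof. by rewrite linear0. Qed.

Lemma dualZ (u : dual X) (a : R) v : u (a *: v) = a * u v.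
Proof. by rewrite linearZ. Qed.

Lemma dual_lincomb n (u : dual X) (c : 'I_n -> R) (v : 'I_n -> X) :
  u (\sum_i c i *: v i) = \sum_i c i * u (v i).
Proof. by rewrite linear_sum; apply: eq_bigr => i _; rewrite linearZ. Qed.

(** The cone spanned by D - x, when D is convex and contains x. *)
Definition feasible (D : set X) x : set X :=
  [set v | exists2 s : R, 0 < s & D (x + s *: v)].

Lemma feasibleD D x v w : convex_set D -> feasible D x v -> feasible D x w ->
  feasible D x (v + w).
Proof.
move=> /convex_setP cD [s s0 Ds] [t t0 Dt].
have st0 : 0 < s + t by exact: addr_gt0.
exists (s * t / (s + t)); first by rewrite divr_gt0// mulr_gt0.
have -> : x + s * t / (s + t) *: (v + w) =
    (t / (s + t)) *: (x + s *: v) + (1 - t / (s + t)) *: (x + t *: w).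
  rewrite !scalerDr addrACA -scalerDl subrKC scale1r !scalerA.
  by congr (_ + (_ *: _ + _ *: _)); field; lra.
apply: cD => //; first by rewrite divr_ge0// ltW.
by rewrite ler_pdivrMr// mul1r lerDr ltW.
Qed.

Lemma feasible0 (D : set X) x : D x -> feasible D x 0.
Proof. by move=> Dx; exists 1; rewrite // scaler0 addr0. Qed.

Lemma feasibleZ D x v (a : R) : D x -> 0 <= a -> feasible D x v -> feasible D x (a *: v).
Proof.
move=> Dx; rewrite le_eqVlt => /orP[/eqP <- _|a0 [s s0 Ds]].
  by rewrite scale0r; exact: feasible0.
by exists (s / a); rewrite ?divr_gt0// scalerA divfK ?gt_eqF.
Qed.

Lemma biorthogonal_le n (v : 'I_n -> X) m (d : 'I_m -> X) (u : 'I_m -> dual X) :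
  (forall j, exists c : 'I_n -> R, d j = \sum_i c i *: v i) ->
  (forall i j, u i (d j) = (i == j)%:R) -> (m <= n)%N.
Proof.
move=> /choice[c dE] ud.
pose C := \matrix_(j < m, k < n) c j k; pose U := \matrix_(k < n, i < m) (u i (v k) : R).
have CU : C *m U = 1%:M.
  apply/matrixP => j i; rewrite !mxE eq_sym -ud dE linear_sum; apply: eq_bigr => k _.
  by rewrite !mxE linearZ.
by rewrite -(mxrank1 R m) -CU (leq_trans (mxrankM_maxl _ _))// rank_leq_col.
Qed.

(** A biorthogonal system of maximal size with vectors in S works: the dual
    separates points, so an element of S not equal to its expansion would allow
    the system to be enlarged. Choosing the vectors in S itself, rather than
    a basis of L, is what makes their sum an interior direction below. *)
Lemma finite_dim_coordinates (L S : set X) : hausdorff_space X ->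
  fin_dim_subspace L -> S `<=` L ->
  exists m (d : 'I_m -> X) (u : 'I_m -> dual X), (forall i, S (d i)) /\
    forall y, S y -> y = \sum_i u i y *: d i.
Proof.
move=> hX [n [v ->]] SL.
pose B m := exists (d : 'I_m -> X) (u : 'I_m -> dual X),
  (forall i, S (d i)) /\ forall i j, u i (d j) = (i == j)%:R.
have B0 : exists m, `[< B m >].
  by exists 0; apply/asboolP; exists (fun=> 0), (fun=> 0); split=> -[].
have Bn m : `[< B m >] -> (m <= n)%N.
  move=> /asboolP[d [u [Sd ud]]]; apply: biorthogonal_le ud => j.
  by have [c _ <-] := SL _ (Sd j); exists c.
case: (ex_maxnP B0 Bn) => m /asboolP[d [u [Sd ud]]] mmax.
exists m, d, u; split=> // y Sy; apply/eqP; rewrite -subr_eq0; apply/eqP.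
set r := y - _; apply: contrapT => /(dual_separates hX)[w0 w0r].
pose w := (w0 r)^-1 *: w0; have wr : w r = 1 by rewrite dual_scaleE mulVf.
(* w corrected so as to vanish on the d_i while keeping its value at r. *)
pose u' : dual X := w - \sum_i w (d i) *: u i.
have u'E a : u' a = w a - \sum_i w (d i) * u i a.
  by rewrite dual_addE dual_oppE dual_sumE.
have u'd j : u' (d j) = 0.
  rewrite u'E (bigD1 j)//= ud eqxx mulr1 big1 ?addr0 ?subrr// => i ij.
  by rewrite ud (negbTE ij) mulr0.
have u'y : u' y = 1.
  rewrite u'E -[RHS]wr /r dualB dual_lincomb; congr (_ - _).
  by apply: eq_bigr => i _; rewrite mulrC.
suff /asboolP/mmax : B m.+1 by rewrite ltnn.
exists (fun i => if unlift ord0 i is Some j then d j else y),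
  (fun i => if unlift ord0 i is Some j then u j - u j y *: u' else u'); split.
  by move=> i; case: unliftP.
move=> i j; case: unliftP => [i' ->|->]; case: unliftP => [j' ->|->].
- by rewrite dual_addE dual_oppE dual_scaleE u'd mulr0 subr0 ud (inj_eq lift_inj).
- rewrite dual_addE dual_oppE dual_scaleE u'y mulr1 subrr.
  by rewrite eq_sym (negbTE (neq_lift _ _)).
- by rewrite u'd (negbTE (neq_lift _ _)).
- by rewrite u'y eqxx.
Qed.

(** The form w minus its expansion vanishes on D - x, so it and its opposite are
    normal; hence z has an expansion in the d_i - x. By finite-dimensional
    separation the coordinates of z are limits of those of feasible directions v, as
    otherwise some normal would be positive at z. When the coordinates of v and z
    differ by less than lam, z + lam * sum (d_i - x) is v plus
    a nonnegative combination of the d_i - x, hence feasible. *)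
Lemma normal_cone_polar (L D : set X) x z : hausdorff_space X ->
  fin_dim_subspace L -> L x -> D `<=` L -> convex_set D -> D x ->
  (forall b, normal_cone D x b -> b z <= 0) ->
  exists m (d : 'I_m -> X), (forall i, D (d i)) /\
    forall lam : R, 0 < lam -> feasible D x (z + lam *: \sum_i (d i - x)).
Proof.
move=> hX fL Lx DL cD Dx bz.
have [m [d [u [Sd dE]]]] : exists m (d : 'I_m -> X) (u : 'I_m -> dual X),
    (forall i, D (x + d i)) /\ forall y, D y -> y - x = \sum_i u i (y - x) *: d i.
  have [|m [d [u [Sd dE]]]] := @finite_dim_coordinates L [set y - x | y in D] hX fL.
    move=> _ [y /DL + <-]; move: fL Lx => [n [v ->]] [c _ <-] [c' _ <-].
    exists (fun i => c' i - c i) => //; rewrite -sumrB.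
    by apply: eq_bigr => i _; rewrite scalerBl.
  exists m, d, u; split=> [i|y Dy]; last by apply: dE; exists y.
  by have [y Dy <-] := Sd i; rewrite subrKC.
exists m, (fun i => x + d i); split=> // lam lam0.
have -> : \sum_i (x + d i - x) = \sum_i d i.
  by apply: eq_bigr => i _; rewrite addrAC subrr add0r.
have zE : z = \sum_i u i z *: d i.
  apply/eqP; rewrite -subr_eq0; apply/eqP; apply: contrapT => /(dual_separates hX)[w].
  pose b : dual X := w - \sum_i w (d i) *: u i.
  have bE a : b a = w (a - \sum_i u i a *: d i).
    rewrite dual_addE dual_oppE dual_sumE dualB dual_lincomb; congr (_ - _).
    by apply: eq_bigr => i _; exact: mulrC.
  have b0 y : D y -> b (y - x) = 0 by move=> /dE yE; rewrite bE -yE subrr linear0.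
  rewrite -bE; apply/negP; rewrite negbK eq_le bz; last by split=> // y /b0 ->.
  rewrite -oppr_le0 -dual_oppE bz//; split=> // y /b0.
  by rewrite dual_oppE => ->; rewrite oppr0.
have feas y : D y -> feasible D x (y - x).
  by move=> Dy; exists 1; rewrite // scale1r subrKC.
pose K : set 'rV[R]_m := [set \row_i u i (v - z) | v in feasible D x].
have cK : convex_set K.
  apply/convex_setP => _ _ t [v fv <-] [w fw <-] t0 t1.
  exists (t *: v + (1 - t) *: w).
    by apply: feasibleD => //; apply: feasibleZ => //; rewrite subr_ge0.
  apply/rowP => i; rewrite !mxE.
  by rewrite !dualB dualD !dualZ; ring.
have [[v fv vz]|H] :=
    pselect (exists2 v, feasible D x v & forall i, `|u i (v - z)| < lam).
  have vE : v = \sum_i u i v *: d i.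
    have [s s0 Ds] := fv; have := dE _ Ds; rewrite addrAC subrr add0r => vE.
    apply: (scalerI (lt0r_neq0 s0)); rewrite {1}vE scaler_sumr.
    by apply: eq_bigr => i _; rewrite dualZ scalerA.
  have -> : z + lam *: (\sum_i d i) = v + \sum_i (lam - u i (v - z)) *: d i.
    rewrite {1}zE {1}vE scaler_sumr -!big_split/=; apply: eq_bigr => i _.
    by rewrite -!scalerDl dualB; congr (_ *: _); ring.
  apply: feasibleD => //.
  apply: (big_ind (feasible D x)) => [|a b|i _].
  - exact: feasible0.
  - exact: feasibleD.
  - apply: feasibleZ => //; last by exists 1; rewrite // scale1r.
    by rewrite subr_ge0 ltW// (le_lt_trans (ler_norm _)).
have [|lm [del [del0 H']]] := row_separation lam0 cK.
  move=> _ [v fv <-]; apply: contrapT => /forallNP Hv; apply: H; exists v => // i.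
  by rewrite ltNge; apply/negP => Hi; apply: (Hv i); rewrite mxE.
pose b : dual X := - \sum_i lm i *: u i.
have key v : feasible D x v -> b v <= b z - del.
  move=> fv; have := H' _ (ex_intro2 _ _ v fv erefl).
  have -> : \sum_i lm i * (\row_i0 u i0 (v - z)) 0 i = - b (v - z).
    rewrite dual_oppE opprK dual_sumE; apply: eq_bigr => i _.
    by rewrite mxE.
  rewrite dualB; lra.
have : b z <= 0.
  apply: bz; split=> // y Dy; rewrite leNgt; apply/negP => by0.
  have bz0 : 0 < b z by have := key _ (feasible0 Dx); rewrite dual0; lra.
  have := key _ (feasibleZ Dx (ltW (divr_gt0 bz0 by0)) (feas y Dy)).
  by rewrite dualZ divfK ?gt_eqF//; lra.
by have := key _ (feasible0 Dx); rewrite dual0; lra.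
Qed.
End FeasibleDirections.

Section WeakStar.
Context {R : realType} {X : tvsType R}.

(** Finitely many evaluations detect that u is off C: the sets of functions
    close to u at finitely many points form a filter converging to u
    pointwise. *)
Lemma weak_star_nbhs (C : set (dual X)) (u : dual X) : closed C -> ~ C u ->
  exists n (z : 'I_n -> X) (e : R), 0 < e /\
    forall w, C w -> exists i, e <= `|u (z i) - w (z i)|.
Proof.
move=> cC Cu; have := closed_openC cC => -[B oB BC].
have Bu : nbhs (u : {ptws X -> R^o}) B.
  by apply: open_nbhs_nbhs; split=> //; have : (~` C) u by []; rewrite -BC.
pose G := filter_from [set p : seq X * R | 0 < p.2]
  (fun p => [set g : {ptws X -> R^o} | forall z, z \in p.1 -> `|u z - g z| < p.2]).
have FG : Filter G.
  apply: filter_from_filter; first by exists ([::], 1); rewrite /=.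
  move=> [s d] [t e] /= d0 e0; exists (s ++ t, Num.min d e).
    by rewrite /= lt_min d0.
  move=> g /= gst; split=> z zs.
    by have := gst z; rewrite mem_cat zs lt_min => /(_ isT) /andP[].
  by have := gst z; rewrite mem_cat zs orbT lt_min => /(_ isT) /andP[].
have Gu : {ptws, G --> (u : X -> R^o)}.
  apply/pointwise_cvgP => z; apply/cvgrPdist_lt => e e0.
  by exists ([:: z], e) => // g /= gz; apply: gz; rewrite mem_head.
have [[s e] /= e0 seB] := Gu B Bu.
exists (size s), (fun i => tnth (in_tuple s) i), e; split=> // w Cw.
apply: contrapT => /forallNP far.
suff : (~` C) w by [].
rewrite -BC; apply: seB => z /= /(nthP 0)[k ks <-].
have := far (Ordinal ks); rewrite (tnth_nth 0)/= => /negP.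
by rewrite -ltNge.
Qed.

(** A weak* continuous form is an evaluation; here it appears directly as
    the combination of the finitely many evaluations that detect u. *)
Lemma weak_star_separation (C : set (dual X)) (u : dual X) : closed C -> convex_set C ->
  ~ C u -> exists z (del : R), 0 < del /\ forall w, C w -> w z <= u z - del.
Proof.
move=> clC /convex_setP cC /(weak_star_nbhs clC)[n [z [e [e0 Ce]]]].
pose K := [set \row_i (u (z i) - w (z i)) | w in C] : set 'rV[R]_n.
have cK : convex_set K.
  apply/convex_setP => _ _ t [v fv <-] [w fw <-] t0 t1.
  exists (t *: v + (1 - t) *: w); first exact: cC.
  by apply/rowP => i; rewrite !mxE dual_addE !dual_scaleE; ring.
have [|lm [del [del0 H]]] := row_separation e0 cK.
  by move=> _ [w /Ce[i ei] <-]; exists i; rewrite mxE.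
exists (\sum_i lm i *: z i), del; split=> // w Cw.
have := H _ (ex_intro2 _ _ w Cw erefl).
have -> : \sum_i lm i * (\row_i0 (u (z i0) - w (z i0))) 0 i =
    u (\sum_i lm i *: z i) - w (\sum_i lm i *: z i).
  rewrite !dual_lincomb -sumrB; apply: eq_bigr => i _; rewrite mxE.
  exact: mulrBr.
lra.
Qed.
End WeakStar.

(** * The two inclusions *)

Section Main.
Context {R : realType} {X : tvsType R} {T : topologicalType}.

Lemma sup_fun_convex (f_ : T -> X -> \bar R) :
  (forall t, convex_efun (f_ t)) -> convex_efun (sup_fun f_).
Proof.
move=> cf; apply/convex_efunP => y z a b t fy fz t0 t1.
apply: ge_ereal_sup => _ [i _ <-]; have /convex_efunP := cf i; apply => //.
  by apply: le_trans fy; apply: ereal_sup_ubound; exists i.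
by apply: le_trans fz; apply: ereal_sup_ubound; exists i.
Qed.

Lemma edom_le (g : X -> \bar R) y : edom g y -> exists M : R, (g y <= M%:E)%E.
Proof.
rewrite /edom/=; case: (g y) => [M| |]// _; first by exists M.
by exists 0; exact: leNye.
Qed.

Lemma fin_dim_subspace_edom_convex (L : set X) (g : X -> \bar R) :
  fin_dim_subspace L -> convex_efun g -> convex_set (L `&` edom g).
Proof.
move=> [n [v ->]] /convex_efunP cg; apply/convex_setP => y z t.
move=> [[c _ <-] /edom_le[a ga]] [[d _ <-] /edom_le[b gb]] t0 t1; split.
  exists (fun i => t * c i + (1 - t) * d i) => //.
  rewrite !scaler_sumr -big_split; apply: eq_bigr => i _.
  by rewrite scalerDl !scalerA.
by apply: le_lt_trans (cg _ _ _ _ _ ga gb t0 t1) _; exact: ltry.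
Qed.

Lemma normal_coneZ (D : set X) x b (k : R) : 0 <= k ->
  normal_cone D x b -> normal_cone D x (k *: b).
Proof. by move=> k0 [Dx bD]; split=> // y /bD by0; rewrite dual_scaleE mulr_ge0_le0. Qed.

Lemma eval_continuous (z : X) : continuous (fun w : dual X => w z : R^o).
Proof.
move=> w; apply: (@continuous_comp _ {ptws X -> R^o} _ (@dual_val R X) (fun g => g z)).
  exact: initial_continuous.
exact: proj_continuous.
Qed.

Lemma halfspace_closed (z : X) (v : \bar R) (eps : R) :
  closed [set w : dual X | ((w z - eps)%:E <= v)%E].
Proof.
case: v => [c| |].
- have -> : [set w : dual X | ((w z - eps)%:E <= c%:E)%E] =
      (fun w : dual X => w z : R^o) @^-1` [set a | a <= c + eps].
    by apply/seteqP; split=> w /=; rewrite lee_fin lerBlDr.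
  by apply: closed_comp => [w _|]; [exact: eval_continuous|exact: closed_le].
- rewrite (_ : [set w : dual X | _] = setT)//.
  by apply/seteqP; split=> w //= _; rewrite leey.
- rewrite (_ : [set w : dual X | _] = set0)//; first exact: closed0.
  by apply/seteqP; split=> w //=; rewrite leeNy_eq.
Qed.

Lemma halfspace_convex (z : X) (v : \bar R) (eps : R) :
  convex_set [set w : dual X | ((w z - eps)%:E <= v)%E].
Proof.
apply/convex_setP => a b t /= az bz t0 t1 /=.
change (((t * a z + (1 - t) * b z - eps)%:E <= v)%E).
case: v az bz => [c| |]; rewrite ?leey// !lee_fin !lerBlDr => az bz.
by apply: le_trans (ler_mix t0 t1 az bz) _; rewrite -mulrDl subrKC mul1r.
Qed.

(** The index set has two elements even when x and y are dependent, so no case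
    distinction is required. *)
Lemma span2_through (x y : X) : exists L : set X, fin_dim_subspaces_through x L /\ L y.
Proof.
pose v (i : 'I_2) := if i == ord0 then x else y.
have vE (a b : R) : \sum_(i < 2) (if i == ord0 then a else b) *: v i = a *: x + b *: y.
  by rewrite !big_ord_recl big_ord0 /= addr0.
exists [set \sum_(i < 2) c i *: v i | c in [set: 'I_2 -> R]]; split; first split.
- by exists 2, v.
- by exists (fun i => if i == ord0 then 1 else 0) => //; rewrite vE scale1r scale0r addr0.
- by exists (fun i => if i == ord0 then 0 else 1) => //; rewrite vE scale1r scale0r add0r.
Qed.

(** When f x is infinite, no active f_t has eps-subgradients at x, and the empty
    set is a closed convex set that excludes every u. *)
Lemma hull_subdiff (f_ : T -> X -> \bar R) x u :
  (forall eps : R, 0 < eps -> forall L, fin_dim_subspaces_through x L ->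
    closed_convex_hull (minkowski_sum (\bigcup_(t in active f_ x) esubdiff eps (f_ t) x)
      (normal_cone (L `&` edom (sup_fun f_)) x)) u) ->
  subdiff (sup_fun f_) x u.
Proof.
move=> hull; have half y eps : 0 < eps -> (sup_fun f_ y < +oo)%E ->
    ((u (y - x) - eps)%:E <= sup_fun f_ y - sup_fun f_ x)%E.
  move=> eps0 fy; have [L [Lx Ly]] := span2_through x y.
  have := hull eps eps0 L Lx
    [set w | ((w (y - x)%R - eps)%:E <= sup_fun f_ y - sup_fun f_ x)%E].
  apply; split; [exact: halfspace_closed|exact: halfspace_convex|].
  move=> _ [a [t /= act [_ af]]] [b [_ bN] <-] /=.
  change (((a (y - x)%R + b (y - x)%R - eps)%:E <= sup_fun f_ y - sup_fun f_ x)%E).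
  have b0 : b (y - x) <= 0 by exact: bN.
  apply: (@le_trans _ _ (a (y - x) - eps)%:E); first by rewrite lee_fin; lra.
  apply: (le_trans (af y)); rewrite act leeB//; apply: ereal_sup_ubound; by exists t.
have fxfin : sup_fun f_ x \is a fin_num.
  apply: contrapT => fxfin; have [L [Lx _]] := span2_through x x.
  have := hull 1 ltr01 L Lx set0; apply; split; [exact: closed0| |].
    by move=> a b t /set_mem.
  by move=> _ [a [t /= act [ftx _]] _]; move: ftx; rewrite act.
split=> // y; rewrite subr0; case E : (sup_fun f_ y) => [q| |].
- apply/lee_addgt0Pr => e e0; have := half y e e0; rewrite E ltry => /(_ isT).
  by rewrite EFinB leeBlDr.
- by rewrite -(fineK fxfin) leey.
- by have := half y 1 ltr01; rewrite E => /(_ isT); rewrite -(fineK fxfin).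
Qed.

Lemma subdiff_hull (f_ : T -> X -> \bar R) x u (e0 eps : R) L : hausdorff_space X ->
  (forall t, convex_efun (f_ t)) ->
  lsc_envelope (sup_fun f_) = sup_fun (fun t => lsc_envelope (f_ t)) ->
  0 < e0 -> compact (eactive f_ e0 x) ->
  (forall z, edom (lsc_envelope (sup_fun f_)) z ->
     usc_on (eactive f_ e0 x) (fun t => lsc_envelope (f_ t) z)) ->
  subdiff (sup_fun f_) x u -> 0 < eps -> fin_dim_subspaces_through x L ->
  closed_convex_hull (minkowski_sum (\bigcup_(t in active f_ x) esubdiff eps (f_ t) x)
    (normal_cone (L `&` edom (sup_fun f_)) x)) u.
Proof.
move=> hX cf clsup e00 kE uscE uf eps0 [fL Lx] C [clC cC subC].
set f := sup_fun f_ in clsup uscE uf subC.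
pose D := L `&` edom f.
have fxfin : f x \is a fin_num by case: uf.
have Dx : D x by split=> //=; rewrite /edom/= -(fineK fxfin) ltry.
have N0 : normal_cone D x 0 by split=> // y _.
apply: contrapT => /(weak_star_separation clC cC)[z [del [del0 sepC]]].
have sep t a b : active f_ x t -> esubdiff eps (f_ t) x a -> normal_cone D x b ->
    a z + b z <= u z - del.
  by move=> act af bN; rewrite -dual_addE; apply/sepC/subC; exists a; [exists t|exists b].
have slope := fun z s del =>
  @slope_active R X T f_ x e0 u z s eps del cf clsup e00 kE uscE uf.
have [t1 [act1 [a1 a1f _]]] : exists t, active f_ x t /\
    exists2 a, esubdiff eps (f_ t) x a & u 0 - 1 <= a 0.
  by apply: (slope 0 1 1) => //; rewrite scaler0 addr0; case: Dx.
have bz b : normal_cone D x b -> b z <= 0.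
  move=> bN; rewrite leNgt; apply/negP => bz0.
  (* A multiple of b large enough to contradict [sep]. *)
  have k0 : 0 <= `|u z - a1 z| / b z by rewrite divr_ge0// ltW.
  have := sep _ _ _ act1 a1f (normal_coneZ k0 bN).
  rewrite dual_scaleE divfK ?gt_eqF//; have := ler_norm (u z - a1 z); lra.
have [m [d [Dd dfeas]]] :=
  normal_cone_polar hX fL Lx (@subIsetl _ _ _)
    (fin_dim_subspace_edom_convex fL (sup_fun_convex cf)) Dx bz.
have /choice[M fM] i : exists M : R, (f (d i) <= M%:E)%E by apply: edom_le; case: (Dd i).
pose k := \sum_i (d i - x); pose B := \sum_i (M i - fine (f x) + eps).
have kB t a : active f_ x t -> esubdiff eps (f_ t) x a -> a k <= B.
  move=> act [_ af]; rewrite /k linear_sum; apply: ler_sum => i _.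
  rewrite -lerBlDr -lee_fin; apply: (le_trans (af (d i))).
  rewrite act EFinB fineK// leeB//; apply: le_trans (fM i).
  by apply: ereal_sup_ubound; exists t.
pose lam := del / (2 * (`|B - u k| + 1)).
have K0 : 0 < `|B - u k| + 1 by rewrite ltr_wpDl.
have lam0 : 0 < lam by rewrite divr_gt0// mulr_gt0.
have lamB : lam * (B - u k) < del / 2.
  have <- : lam * (`|B - u k| + 1) = del / 2.
    by rewrite /lam invfM mulrA divfK// gt_eqF.
  by rewrite ltr_pM2l//; have := ler_norm (B - u k); lra.
have [s s0 [_ Ds]] := dfeas lam lam0.
have [t [act [a af]]] := slope (z + lam *: k) s (del / 2) s0 Ds eps0
  (divr_gt0 del0 (ltr0n _ 2)).
rewrite !dualD !dualZ => au.
have := sep _ _ _ act af N0; rewrite addr0 => az.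
have := ler_wpM2l (ltW lam0) (kB _ _ act af).
rewrite mulrBr in lamB; lra.
Qed.

End Main.

Theorem theorem5 (R : realType) (X : tvsType R) (hX : hausdorff_space X)
    (T : topologicalType) (f_ : T -> X -> \bar R)
    (f_convex : forall t, convex_efun (f_ t))
    (cl_sup : lsc_envelope (sup_fun f_) = sup_fun (fun t => lsc_envelope (f_ t)))
    (x : X)
    (hx : exists eps0 : R, [/\ 0 < eps0,
      compact (eactive f_ eps0 x) &
      forall z, edom (lsc_envelope (sup_fun f_)) z ->
        usc_on (eactive f_ eps0 x) (fun t => lsc_envelope (f_ t) z)]) :
  subdiff (sup_fun f_) x =
  \bigcap_(eps in [set eps : R | 0 < eps])
    \bigcap_(L in fin_dim_subspaces_through x)
      closed_convex_hull
        (minkowski_sum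
          (\bigcup_(t in active f_ x) esubdiff eps (f_ t) x)
          (normal_cone (L `&` edom (sup_fun f_)) x)).
Proof.
have [e0 [e00 kE uscE]] := hx; apply/seteqP; split=> [u uf eps eps0 L Lx|u uhull].
  exact: (subdiff_hull hX f_convex cl_sup e00 kE uscE).
exact: hull_subdiff.
Qed.
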